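(* Let $(K,v)$ be a Henselian valued field, let $\theta\in\overline{K}$ be separable and defectless over $K$, of degree $n>1$, and let $[\alpha_0,\alpha_1,\dots,\alpha_{r-1},\alpha_r=\theta]$ be an Okutsu sequence of $\theta$ with $\alpha_0,\dots,\alpha_{r-1}$ separable over $K$. Put $\delta_{-1}=-\infty$, $\delta_i=v(\theta-\alpha_i)$ for $0\le i\le r$ (so $\delta_r=\infty$). For $0\le i\le r$ let $M/K$ be a finite Galois extension containing $K(\theta,\alpha_i)$, let $G=\operatorname{Gal}(M/K)$ and $$H_i=\{\sigma\in G\mid v(\theta-\sigma(\theta))>\delta_{i-1}\}\supseteq \overline{H}_i=\{\sigma\in G\mid v(\theta-\sigma(\theta))\ge\delta_i\}.$$ If for some $0\le i\le r$ the element $\alpha_i$ is tame over $K$, then $H_i=\overline{H}_i$. In particular, if $\theta$ is tame over $K$, then $\delta(\theta)=\omega(\theta)$.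
   Context: $(K,v)$ is a Henselian valued field of arbitrary rank; $v$ also denotes its unique extension to a fixed algebraic closure $\overline{K}$; $\deg_K\alpha=[K(\alpha):K]$. For a finite simple extension $L/K$, the defect $d(L/K)$ is defined by $[L:K]=e(L/K)f(L/K)d(L/K)$, where $e$ is the ramification index and $f$ the inertia degree. $L/K$ is defectless if $d(L/K)=1$. A separable and defectless extension $L/K$ is tame if the residue field extension $Lv/Kv$ is separable and $e(L/K)$ is not divisible by $\operatorname{char}(Kv)$. An element $\alpha\in\overline{K}$ is said to be separable, defectless, tame if $K(\alpha)/K$ is. An Okutsu sequence of the defectless element $\theta$ is a list $[\alpha_0,\dots,\alpha_{r-1},\alpha_r=\theta]$ in $\overline{K}$ with degrees $m_i=\deg_K\alpha_i$ satisfying $1=m_0<m_1<\cdots<m_r=n$, such that for all $0\le i<r$ and all $\beta\in\overline{K}$: $\deg_K\beta<m_{i+1}\Rightarrow v(\theta-\beta)\le v(\theta-\alpha_i)$; and $\deg_K\beta<m_i\Rightarrow v(\theta-\beta)<v(\theta-\alpha_i)$. The main invariant of $\theta$ is $\delta(\theta)=\sup\{v(\theta-\alpha)\mid\alpha\in\overline{K},\ \deg_K\alpha<\deg_K\theta\}$ (equal here to $\delta_{r-1}$). Krasner's constant of $\theta$ is $\omega(\theta)=\max\{v(\theta-\theta')\mid \theta'\ne\theta \text{ a root in }\overline{K}\text{ of the minimal polynomial of }\theta\text{ over }K\}$. *)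

(* Defs.v *)
From HB Require Import structures.
From mathcomp Require Import all_boot all_order all_algebra all_fingroup.
From mathcomp Require Import all_solvable all_field.
From mathcomp Require Import generic_quotient ring_quotient.
From mathcomp Require Import boolp classical_sets functions cardinality.

Set Implicit Arguments.
Unset Strict Implicit.
Unset Printing Implicit Defensive.

Import Order.TTheory GRing.Theory Num.Theory.

Local Open Scope ring_scope.
Local Open Scope quotient_scope.

(* Totally ordered abelian groups.  Num.POrderedZmodule does not relate the   *)
(* order to the addition.                                                     *)
Structure oagType := OrderedAbGroup {
  oag_sort :> porderZmodType;
  oag_le_total : total (<=%R : rel oag_sort);
  oag_leD2r : forall z x y : oag_sort, x <= y -> x + z <= y + z
}.

(* [extval G] is G together with -oo and +oo.  Valuations take their values   *)
(* in G and +oo; -oo is used as the convention for delta_{-1}.                *)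
Inductive extval (G : Type) := Minfty | Fin of G | Pinfty.
Arguments Minfty {G}.
Arguments Pinfty {G}.

Section ExtvalOrder.
Context {G : oagType}.

Definition extval_code (x : extval G) : option (option G) :=
  match x with
  | Minfty => None | Fin g => Some (Some g) | Pinfty => Some None
  end.

Definition extval_decode (x : option (option G)) : extval G :=
  match x with
  | None => Minfty | Some (Some g) => Fin g | Some None => Pinfty
  end.

Lemma extval_codeK : cancel extval_code extval_decode.
Proof. by case. Qed.

HB.instance Definition _ := Choice.copy (extval G) (can_type extval_codeK).

Definition extval_le (x y : extval G) : bool :=
  match x, y with
  | Minfty, _ => true
  | _, Pinfty => true
  | Fin a, Fin b => a <= b
  | _, _ => false
  end.

Lemma extval_le_refl : reflexive extval_le.
Proof. by case=> //= a. Qed.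

Lemma extval_le_anti : antisymmetric extval_le.
Proof. by case=> [|a|] [|b|] //= /le_anti ->. Qed.

Lemma extval_le_trans : transitive extval_le.
Proof. by case=> [|b|] [|a|] [|c|] //=; apply: le_trans. Qed.

HB.instance Definition _ := Order.Le_isPOrder.Build ring_display (extval G)
  extval_le_refl extval_le_anti extval_le_trans.

Lemma extval_le_total : total (<=%O : rel (extval G)).
Proof. by case=> [|a|] [|b|] //; exact: (oag_le_total a b). Qed.

HB.instance Definition _ :=
  Order.POrder_isTotal.Build ring_display (extval G) extval_le_total.

(* The value of [extval_add Minfty Pinfty] is irrelevant. *)
Definition extval_add (x y : extval G) : extval G :=
  match x, y with
  | Minfty, _ | _, Minfty => Minfty
  | Pinfty, _ | _, Pinfty => Pinfty
  | Fin a, Fin b => Fin (a + b)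
  end.

End ExtvalOrder.

(* The value group of a valuation is its image on nonzero elements, which     *)
(* need not be all of G.                                                      *)
Record valuation (F : fieldType) (G : oagType) := Valuation {
  val_of :> F -> extval G;
  val_Minfty : forall x, val_of x != Minfty;
  val_Pinfty : forall x, (val_of x == Pinfty) = (x == 0);
  valM : forall x y, val_of (x * y) = extval_add (val_of x) (val_of y);
  valD : forall x y, Num.min (val_of x) (val_of y) <= val_of (x + y)
}.

Section ResidueField.
Context (F : fieldType) (G : oagType) (v : valuation F G).

Lemma Fin_le (a b : G) : (Fin a <= Fin b) = (a <= b).
Proof. by []. Qed.

Lemma Fin_lt (a b : G) : (Fin a < Fin b) = (a < b).
Proof. by rewrite !lt_neqAle Fin_le; congr (~~ _ && _). Qed.

Lemma val_finP x : x != 0 -> exists g, v x = Fin g.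
Proof.
rewrite -(val_Pinfty v); have := val_Minfty v x.
by case: (v x) => // g _ _; exists g.
Qed.

Lemma val0 : v 0 = Pinfty.
Proof. by apply/eqP; rewrite val_Pinfty. Qed.

Lemma val1 : v 1 = Fin 0.
Proof.
have [g vg] := val_finP (oner_neq0 F).
have := valM v 1 1; rewrite mulr1 vg /= => -[] /eqP.
by rewrite -{1}[g]addr0 (inj_eq (addrI g)) => /eqP <-.
Qed.

Lemma oag_ltD2 (a b : G) : 0 <= a -> 0 < b -> 0 < a + b.
Proof.
move=> a0 b0; apply: lt_le_trans b0 _.
by have := oag_leD2r b a0; rewrite add0r.
Qed.

Lemma oag_double0 (a : G) : a + a = 0 -> a = 0.
Proof.
move=> aa0; apply: le_anti.
have [a0|a0] := orP (oag_le_total 0 a).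
  by have := oag_leD2r a a0; rewrite aa0 add0r a0 => ->.
by have := oag_leD2r a a0; rewrite aa0 add0r a0 => ->.
Qed.

Lemma valN1 : v (-1) = Fin 0.
Proof.
have n1 : (-1 : F) != 0 by rewrite oppr_eq0 oner_neq0.
have [g vg] := val_finP n1.
have := valM v (-1) (-1); rewrite mulrNN mulr1 val1 vg /= => -[] /esym gg.
by rewrite (oag_double0 gg).
Qed.

Lemma valN x : v (- x) = v x.
Proof.
rewrite -mulN1r valM valN1; have := val_Minfty v x.
by case: (v x) => //= g _; rewrite add0r.
Qed.

Definition vint : {pred F} := fun x => Fin 0 <= v x.

Lemma vintE x : (x \in vint) = (Fin 0 <= v x).
Proof. by []. Qed.

Lemma vint_subring : subring_closed vint.
Proof.
split=> [|x y|x y]; rewrite !vintE ?val1 // => x0 y0.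
  by apply: le_trans (valD v _ _); rewrite le_min x0 valN y0.
move: x0 y0; rewrite valM; case: (v x) => [|a|] //; case: (v y) => [|b|] //=.
rewrite !Fin_le => a0 b0; apply: le_trans b0 _.
by have := oag_leD2r b a0; rewrite add0r.
Qed.

HB.instance Definition _ := GRing.isSubringClosed.Build F vint vint_subring.

Definition vring := {x : F | x \in vint}.

HB.instance Definition _ := SubChoice.on vring.
HB.instance Definition _ := [SubChoice_isSubComNzRing of vring by <:].

Definition vmax : {pred vring} := fun x => Fin 0 < v (val x).

Lemma vmaxE x : (x \in vmax) = (Fin 0 < v (val x)).
Proof. by []. Qed.

Lemma vmax_idealr : idealr_closed vmax.
Proof.
split=> [||a x y]; rewrite !vmaxE ?val0 ?val1 ?ltxx // => x0 y0; apply: lt_le_trans (valD v _ _); rewrite lt_min y0 andbT.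
have a0 : Fin 0 <= v (val a) := valP a.
move: a0 x0; rewrite valM; case: (v (val a)) => [|p|] //.
  case: (v (val x)) => [|q|] //=; rewrite Fin_le !Fin_lt; exact: oag_ltD2.
by case: (v (val x)).
Qed.

HB.instance Definition _ := isIdealr.Build vring vmax vmax_idealr.

Definition residue := {ideal_quot vmax}.

HB.instance Definition _ := GRing.ComNzRing.on residue.
HB.instance Definition _ := NzRingQuotient.on residue.

(* [insubd 0] falls back to 0 when its argument is not integral, which        *)
(* happens here only for the class 0.                                         *)
Definition residue_inv (x : residue) : residue :=
  \pi_residue (insubd (0 : vring) (val (repr x))^-1).

Lemma residue_pi0 (x : vring) : (\pi_residue x == 0) = (Fin 0 < v (val x)).
Proof.
have -> : (0 : residue) = \pi_residue 0 by rewrite rmorph0.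
by rewrite -[LHS](@Quotient.idealrBE _ vmax) subr0 vmaxE.
Qed.

Lemma residue_mulVf x : x != 0 -> residue_inv x * x = 1.
Proof.
rewrite -{1}[x]reprK residue_pi0 -leNgt => vx0.
set y := repr x in vx0 *.
have vy : v (val y) = Fin 0.
  by apply/le_anti; rewrite vx0; exact: (valP y).
have y0 : val y != 0 by rewrite -(val_Pinfty v) vy.
have vyV : (val y)^-1 \in vint.
  have yV0 : (val y)^-1 != 0 by rewrite invr_eq0.
  have [g vg] := val_finP yV0.
  have := valM v (val y) (val y)^-1; rewrite divff // val1 vy vg /= add0r.
  by move=> -[] g0; rewrite vintE vg -g0.
rewrite /residue_inv -/y -[X in _ * X]reprK -/y.
rewrite -rmorphM -[RHS](rmorph1 (\pi_residue)); congr (\pi_residue _).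
by apply: val_inj; rewrite /= insubdK // mulVf.
Qed.

Lemma residue_inv0 : residue_inv 0 = 0.
Proof.
apply/eqP; rewrite /residue_inv residue_pi0.
have : Fin 0 < v (val (repr (0 : residue))) by rewrite -residue_pi0 reprK.
set y := val _ => vy.
have [->|y0] := eqVneq y 0.
  by rewrite invr0 insubdK ?val0 // rpred0.
rewrite /insubd insubF /= ?val0 //; apply/negP => yV.
have : Fin 0 <= v y^-1 := yV.
have := valM v y y^-1; rewrite divff // val1.
move: vy; case: (v y) => [|a|] //; case: (v y^-1) => [|b|] //=.
rewrite Fin_lt Fin_le => a0 -[] /esym ab b0.
by have := oag_ltD2 b0 a0; rewrite addrC ab ltxx.
Qed.

HB.instance Definition _ :=
  GRing.ComNzRing_isField.Build residue residue_mulVf residue_inv0.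

End ResidueField.

Local Open Scope classical_set_scope.

(* Subextensions of a field extension f : F -> E, as subsets of E.            *)
Section Extensions.
Context (F E : fieldType) (f : F -> E).

Definition is_basis (V : set E) (n : nat) (b : 'I_n -> E) : Prop :=
  (forall c : 'I_n -> F, \sum_(i < n) f (c i) * b i = 0 -> forall i, c i = 0)
  /\ V = [set x | exists c : 'I_n -> F, x = \sum_(i < n) f (c i) * b i].

(* [V : F], with value 0 if the dimension is infinite. *)
Definition ext_degree (V : set E) : nat :=
  xget 0%N [set n | exists b : 'I_n -> E, is_basis V b].

(* F(a), as the set of fractions in a; fractions with denominator vanishing   *)
(* at a are 0 as x / 0 = 0.                                                   *)
Definition adjoin (a : E) : set E :=
  [set x | exists p q : {poly F}, x = (map_poly f p).[a] / (map_poly f q).[a]].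

Definition elt_degree (a : E) : nat := ext_degree (adjoin a).

(* The minimal polynomial of a over F, or 0 if a is not algebraic. *)
Definition minpoly (a : E) : {poly F} :=
  xget 0 [set p | [/\ p \is monic, irreducible_poly p & root (map_poly f p) a]].

(* [separable_poly 0] is false, so this implies that V is algebraic. *)
Definition separable_ext (V : set E) : Prop :=
  forall x, V x -> separable_poly (minpoly x).

End Extensions.

Section ValuedExtensions.
Context (F E : fieldType) (G G' : oagType) (f : F -> E).
Context (v : valuation F G) (w : valuation E G').

Definition value_group (L : set E) : set G' :=
  [set g | exists2 x, L x & w x = Fin g].

(* The map Fv -> Ew induced by f; the default value of [insubd] is not used   *)
(* when w extends v.                                                          *)
Definition residue_map (x : residue v) : residue w :=
  \pi_(residue w) (insubd (0 : vring w) (f (val (repr x)))).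

Definition residue_set (L : set E) : set (residue w) :=
  [set y | exists2 x : vring w, L (val x) & y = \pi_(residue w) x].

(* The index of the value group of F in that of L, as the number of cosets    *)
(* of the former in the latter (0 if infinite).                               *)
Definition ramification_index (L : set E) : nat :=
  xget 0%N [set n |
    ([set [set a + b | b in value_group (range f)] | a in value_group L]
       #= `I_n)%card].

Definition inertia_degree (L : set E) : nat :=
  ext_degree residue_map (residue_set L).

Definition has_defect (L : set E) (d : nat) : Prop :=
  ext_degree f L = (ramification_index L * inertia_degree L * d)%N.

Definition defectless_ext (L : set E) : Prop := has_defect L 1.

Definition tame_ext (L : set E) : Prop :=
  [/\ separable_ext f L, defectless_ext L,
      separable_ext residue_map (residue_set L) &
      forall p : nat, p \in [pchar (residue v)] ->
        ~~ (p %| ramification_index L)%N].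

Definition separable_elt (a : E) : Prop := separable_ext f (adjoin f a).
Definition defectless_elt (a : E) : Prop := defectless_ext (adjoin f a).
Definition tame_elt (a : E) : Prop := tame_ext (adjoin f a).

End ValuedExtensions.

(* w extends v up to an identification of value groups, i.e. the valuation    *)
(* ring of w lies over that of v.                                             *)
Definition prolongs (F E : fieldType) (G G' : oagType) (f : F -> E)
    (v : valuation F G) (w : valuation E G') : Prop :=
  forall x, (Fin 0 <= w (f x)) = (Fin 0 <= v x).

(* Two valuations are equivalent when they have the same valuation ring. *)
Definition equiv_val (F : fieldType) (G G' : oagType)
    (v : valuation F G) (w : valuation F G') : Prop :=
  forall x, (Fin 0 <= v x) = (Fin 0 <= w x).

(* (K, v) is Henselian: v has, up to equivalence, a unique extension to every *)
(* algebraic extension of K (existence always holds).                         *)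
Definition henselian (K : fieldType) (G : oagType) (v : valuation K G) : Prop :=
  forall (L : fieldType) (f : {rmorphism K -> L}),
    (forall z, algebraicOver f z) ->
  forall (G1 G2 : oagType) (w1 : valuation L G1) (w2 : valuation L G2),
    prolongs f v w1 -> prolongs f v w2 -> equiv_val w1 w2.

Section Okutsu.
Context (K Kbar : fieldType) (G : oagType) (iota : K -> Kbar).
Context (vbar : valuation Kbar G).

Local Notation deg := (elt_degree iota).

(* [r] is the index of the last entry of the list. *)
Definition okutsu_sequence (theta : Kbar) (r : nat) (alpha : r.+1.-tuple Kbar)
    : Prop :=
  [/\ alpha`_r = theta,
      deg alpha`_0 = 1%N,
      forall i, (i < r)%N -> (deg alpha`_i < deg alpha`_i.+1)%N,
      forall i beta, (i < r)%N -> (deg beta < deg alpha`_i.+1)%N ->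
        vbar (theta - beta) <= vbar (theta - alpha`_i) &
      forall i beta, (i < r)%N -> (deg beta < deg alpha`_i)%N ->
        vbar (theta - beta) < vbar (theta - alpha`_i)].

Definition delta (theta : Kbar) (alpha : seq Kbar) (i : nat) : extval G :=
  vbar (theta - alpha`_i).

(* delta_{i-1}, with delta_{-1} = -oo. *)
Definition delta_pred (theta : Kbar) (alpha : seq Kbar) (i : nat) : extval G :=
  if i is i'.+1 then delta theta alpha i' else Minfty.

Definition is_main_invariant (theta : Kbar) (d : extval G) : Prop :=
  supremums [set vbar (theta - a) | a in
               [set a | (deg a < deg theta)%N]] d.

Definition is_krasner_constant (theta : Kbar) (d : extval G) : Prop :=
  let A := [set vbar (theta - theta') | theta' in
              [set theta' | theta' != theta /\
                            root (map_poly iota (minpoly iota theta)) theta']] in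
  A d /\ ubound A d.

Context (M : splittingFieldType K) (j : M -> Kbar).

Definition H_group (theta : M) (d : extval G) : {set gal_of {:M}} :=
  [set s in ('Gal({:M} / 1))%g | d < vbar (j theta - j (s theta))]%SET.

Definition Hbar_group (theta : M) (d : extval G) : {set gal_of {:M}} :=
  [set s in ('Gal({:M} / 1))%g | d <= vbar (j theta - j (s theta))]%SET.

End Okutsu.

(* Main.v *)
(* The point is an approximation property of a tame element a of a Galois      *)
(* extension M: if s moves a, some b of smaller degree satisfies               *)
(* w(a - s a) <= w(a - b).  Let H be the group of all t with                   *)
(* w(a - s a) <= w(a - t a) and S the stabiliser of a.  For an integral z in   *)
(* K(a) generating the residue extension, the group T of all t fixing the      *)
(* residue of z has index f in the Galois group, so [T : S] = e by             *)
(* defectlessness, and its divisor [H :&: T : S] is nonzero in the residue     *)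
(* field.  Hence some power u of z has a unit "trace" over the cosets of S in  *)
(* H, and the average b of a over these cosets with weights u is fixed by H,   *)
(* so that its degree is at most [Gal : H].                                    *)
(* If s lies in H_i but not in its subgroup, then                              *)
(* w(alpha_i - s alpha_i) = w(theta - s theta), and b contradicts the          *)
(* minimality in the Okutsu sequence; delta <= omega is Krasner's lemma.       *)

Require Import Defs.
From HB Require Import structures.
From mathcomp Require Import boolp classical_sets.
From mathcomp Require Import generic_quotient ring_quotient.
From mathcomp Require Import all_boot all_order all_algebra all_fingroup.
From mathcomp Require Import all_solvable all_field.

Set Implicit Arguments.
Unset Strict Implicit.
Unset Printing Implicit Defensive.

Import Order.TTheory GRing.Theory Num.Theory.

Local Open Scope ring_scope.

(** Everything rests on [tame_approximation]: if s moves a tame element a, some b of smaller degree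
    is at least as close to a as s a is. Suppose s lies in H_i but not in its subgroup, so that
    delta_{i-1} < v(theta - s theta) < delta_i. As alpha_i differs from theta only by something of
    value delta_i, also v(alpha_i - s alpha_i) = v(theta - s theta). The b obtained for alpha_i is
    then closer to theta than alpha_{i-1}, against the Okutsu property; for i = 0 it would have
    degree below 1. Applied to a tame theta, the same lemma gives omega <= delta, and Krasner's
    argument gives the converse.

    The element b is a weighted average of the conjugates of a over the cosets of S = Gal(M/K(a)) in
    a larger group H. A plain average would divide by [H : S], which may vanish in the residue
    field, as tameness restricts e but not f. Weighting by powers of a generator z of the residue
    extension separates the cosets by the residue of their conjugate of z. By [index_res_stab] each
    such class has a size dividing e, and [exists_power_sum_neq0] then finds a power of z whose
    trace is a unit. The Henselian hypothesis enters through [gal_val_inv]: Galois automorphisms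
    preserve the valuation. *)

(** * Minimal polynomials of algebraic elements *)

Section AlgebraicElements.
Context (K E : fieldType) (i : {rmorphism K -> E}).
Implicit Types (x : E) (p q : {poly K}).

(** A nonzero polynomial of least degree vanishing at x is irreducible; dividing by the leading
    coefficient makes it monic. *)
Lemma exists_irreducible_root x :
  algebraicOver i x ->
  exists p, [/\ p \is monic, irreducible_poly p & root (map_poly i p) x].
Proof.
case=> q0 nz0 q0x.
pose P n := `[< exists p, [/\ p != 0, root (map_poly i p) x & size p = n] >].
have exP : exists n, P n by exists (size q0); apply/asboolP; exists q0.
case: (ex_minnP exP) => n /asboolP[p [nzp px szp]] minn.
have irrp : irreducible_poly p.
  apply/(subfx_irreducibleP px nzp) => q qx nzq.
  by rewrite szp; apply: minn; apply/asboolP; exists q.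
have lc0 : (lead_coef p)^-1 != 0 by rewrite invr_eq0 lead_coef_eq0.
exists ((lead_coef p)^-1 *: p); split.
- by rewrite monicE lead_coefZ mulVf // lead_coef_eq0.
- have [sz irr] := irrp; split=> [|q nq qp]; first by rewrite size_scale.
  rewrite (eqp_trans (irr q nq _)) //; first by rewrite dvdpZr in qp.
  by rewrite eqp_sym eqp_scale.
- by rewrite map_polyZ rootZ ?fmorph_eq0.
Qed.

Lemma irreducible_root_dvdp x p q :
  irreducible_poly p -> root (map_poly i p) x ->
  root (map_poly i q) x = (p %| q).
Proof.
move=> irrp px; apply/idP/idP => [qx|/dvdpP[r ->]]; last first.
  by rewrite rmorphM rootM px orbT.
suff: gcdp p q %= p by move/eqp_dvdl <-; exact: dvdp_gcdr.
have [sz irr] := irrp; apply: irr (dvdp_gcdl _ _).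
rewrite -(size_map_poly i) gtn_eqF // (@root_size_gt1 _ x) //.
  by rewrite map_poly_eq0 gcdp_eq0 negb_and irredp_neq0.
by rewrite gcdp_map root_gcd px qx.
Qed.

Lemma irreducible_root_uniq x p q :
  p \is monic -> q \is monic -> irreducible_poly p -> irreducible_poly q ->
  root (map_poly i p) x -> root (map_poly i q) x -> p = q.
Proof.
move=> mp mq ip iq px qx; apply/eqP; rewrite -eqp_monic // /eqp.
by rewrite -(irreducible_root_dvdp _ ip px) -(irreducible_root_dvdp _ iq qx) qx.
Qed.

Lemma minpolyP x :
  algebraicOver i x ->
  [/\ minpoly i x \is monic, irreducible_poly (minpoly i x)
    & root (map_poly i (minpoly i x)) x].
Proof.
move=> /exists_irreducible_root[p pP].
exact: (@xgetPex _ 0 [set p | [/\ p \is monic, irreducible_poly p &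
  root (map_poly i p) x]]%classic (ex_intro _ p pP)).
Qed.

Lemma separable_minpoly_algebraic x :
  separable_poly (minpoly i x) -> algebraicOver i x.
Proof.
rewrite /minpoly; case: xgetP => [p _ [mp ip px] sp|_].
  by exists p => //; exact: irredp_neq0.
by move/separable_poly_neq0; rewrite eqxx.
Qed.

Lemma adjoin_id x : adjoin i x x.
Proof.
exists 'X, 1; rewrite map_polyX hornerX rmorph1 hornerC divr1 //.
Qed.

End AlgebraicElements.

(** * Abstract finite extensions generated by given elements of E *)

Section BaseFieldEmbedding.
Context (K : fieldType) (L : fieldExtType K) (L' : fieldExtType L).

(** The inclusion of L in L', retyped so that its target is an extension of K and it can be declared
    K-linear. *)
Definition to_baseField : L -> baseFieldType L' := in_alg L'.

HB.instance Definition _ := GRing.RMorphism.copy to_baseField (in_alg L').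

Lemma to_baseField_scalable : scalable to_baseField.
Proof.
move=> a u; rewrite baseField_scaleE -[a *: u]mulr_algl.
by rewrite rmorphM /= /to_baseField /= mulr_algl.
Qed.

HB.instance Definition _ :=
  GRing.isScalable.Build K L (baseFieldType L') *:%R to_baseField
    to_baseField_scalable.

Lemma base_adjoin_seq_full (ys : seq L) (z : baseFieldType L') :
  <<1 & ys>>%VS = {:L}%VS -> (forall u : L', exists q : {poly L},
     u = (map_poly (in_alg L') q).[z]) ->
  <<1 & z :: map to_baseField ys>>%VS = fullv.
Proof.
move=> ysf genz; apply/vspaceP=> u; rewrite memvf.
set V := <<_ & _>>%VS.
have inV c : to_baseField c \in V.
  pose g : {lrmorphism L -> baseFieldType L'} := to_baseField.
  have : g c \in (linfun g @: <<1 & ys>>)%VS.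
    by rewrite -[g c](lfunE g) memv_img // ysf memvf.
  rewrite (aimg_adjoin_seq (linfun_ahom g)) aimg1 => gc.
  have -> : V = <<<<1; z>> & map g ys>>%VS by rewrite /V adjoin_cons.
  apply: subvP gc; rewrite (eq_map (lfunE g)); apply: adjoin_seqSl.
  by rewrite sub1v.
have [q ->] := genz u.
apply: (@rpred_horner _ V).
  by apply/polyOverP=> k; rewrite coef_map; exact: inV.
by rewrite seqv_sub_adjoin ?mem_head.
Qed.

End BaseFieldEmbedding.

(** The elements are adjoined one at a time, each through its irreducible polynomial over the field
    built so far. This carries questions about subsets of E into finite extensions of K, where
    linear algebra and Galois theory apply. *)
Lemma exists_extension_generated (K E : fieldType) (i : {rmorphism K -> E})
    (xs : seq E) :
  (forall x, x \in xs -> algebraicOver i x) ->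
  exists (L : fieldExtType K) (j : {rmorphism L -> E}) (ys : seq L),
    [/\ forall a : K, j a%:A = i a, map j ys = xs
      & <<1 & ys>>%VS = {:L}%VS].
Proof.
elim: xs => [|x xs IH] algxs.
  exists (K^o : fieldExtType K), (i : {rmorphism K^o -> E}), [::].
  split=> //; first by move=> a /=; rewrite [a%:A]mulr1.
  apply/vspaceP=> u; rewrite memvf Fadjoin_nil.
  by rewrite -[u]mulr1 memvZ ?mem1v.
have /IH[L [j [ys [ji ysx ysf]]]] : forall y, y \in xs -> algebraicOver i y.
  by move=> y yxs; apply: algxs; rewrite inE yxs orbT.
have [p0 nz0 p0x] := algxs x (mem_head _ _).
have algx : algebraicOver j x.
  exists (map_poly (in_alg L) p0); first by rewrite map_poly_eq0.
  by rewrite -map_poly_comp (eq_map_poly (ji : _ \o _ =1 _)).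
have [p [mp irrp px]] := exists_irreducible_root algx.
pose L' := SubFieldExtType px irrp.
pose j' : {rmorphism L' -> E} := @subfx_inj _ _ j x p.
pose z : baseFieldType L' := subfx_root j x p.
have jz : j' z = x by apply: subfx_inj_root px (irredp_neq0 irrp).
have jj (c : L) : j' (to_baseField L' c) = j c.
  by apply: subfx_inj_base px (irredp_neq0 irrp) c.
exists (baseFieldType L' : fieldExtType K), j', (z :: map (to_baseField L') ys).
split=> [a||].
- by rewrite baseField_scaleE -ji -(jj a%:A).
- rewrite /= jz -map_comp -ysx; congr (_ :: _).
  by apply: eq_map => c /=; exact: jj.
- apply: base_adjoin_seq_full => // u.
  by have [q ->] := subfxEroot px (irredp_neq0 irrp) u; exists q.
Qed.

(** * Degrees and minimal polynomials computed in a finite extension; primitive elements *)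

Section Degree.
Context (K E : fieldType) (i : {rmorphism K -> E}).
Context (L : fieldExtType K) (j : {rmorphism L -> E}).
Hypothesis ji : forall a : K, j a%:A = i a.
Implicit Types (U : {vspace L}) (x t : L).

Definition img_set U : set E := [set j x | x in [set x | x \in U]]%classic.

Lemma is_basis_dim U n (b : 'I_n -> E) : is_basis i (img_set U) b -> \dim U = n.
Proof.
case=> bfree Vb.
have jZ a u : j (a *: u) = i a * j u by rewrite -mulr_algl rmorphM ji.
have bU k : exists u, u \in U /\ j u = b k.
  have : img_set U (b k).
    rewrite Vb; exists (fun l => (l == k)%:R).
    rewrite (bigD1 k) //= eqxx rmorph1 mul1r big1 ?addr0 // => l /negPf ->.
    by rewrite rmorph0 mul0r.
  by case=> u uU ju; exists u.
have [u uP] := choice bU.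
pose X := [tuple u k | k < n].
have jX (c : 'I_n -> K) : j (\sum_(k < n) c k *: X`_k) = \sum_(k < n) i (c k) * b k.
  rewrite rmorph_sum; apply: eq_bigr => k _.
  by rewrite jZ -tnth_nth tnth_mktuple (uP k).2.
have freeX : free X.
  apply/freeP => c; move/(congr1 j); rewrite jX rmorph0; exact: bfree.
have spanX : <<X>>%VS = U.
  apply/eqP; rewrite eqEsubv; apply/andP; split.
    by apply/span_subvP => _ /mapP[k _ ->]; exact: (uP k).1.
  apply/subvP => x xU.
  have : img_set U (j x) by exists x.
  rewrite Vb => -[c]; rewrite -jX => /fmorph_inj ->.
  by apply: memv_suml => k _; rewrite memvZ // memv_span // -tnth_nth mem_tnth.
have := freeX; rewrite /free spanX size_tuple => /eqP //.
Qed.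

Lemma is_basis_img U : exists b : 'I_(\dim U) -> E, is_basis i (img_set U) b.
Proof.
have jX (c : 'I_(\dim U) -> K) :
    j (\sum_(k < \dim U) c k *: (vbasis U)`_k)
      = \sum_(k < \dim U) i (c k) * j (vbasis U)`_k.
  rewrite rmorph_sum; apply: eq_bigr => k _.
  by rewrite -mulr_algl rmorphM ji.
exists (fun k => j (vbasis U)`_k); split=> [c|].
  rewrite -jX => /eqP; rewrite fmorph_eq0 => /eqP.
  exact/freeP/(basis_free (vbasisP U)).
apply/seteqP; split=> [_ [x xU <-]|_ [c ->]].
  by exists (fun k => coord (vbasis U) k x); rewrite -jX -coord_vbasis.
rewrite -jX; eexists; last by []; rewrite /=.
apply: memv_suml => k _; rewrite memvZ // vbasis_mem // mem_nth //.
by rewrite size_tuple.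
Qed.

Lemma ext_degree_img U : ext_degree i (img_set U) = \dim U.
Proof.
rewrite /ext_degree; case: xgetP => [n _ [b bP]|none].
  by rewrite (is_basis_dim bP).
by case: (none (\dim U)); exact: is_basis_img.
Qed.

Lemma horner_img (p : {poly K}) t :
  (map_poly i p).[j t] = j (map_poly (in_alg L) p).[t].
Proof.
rewrite -horner_map -map_poly_comp; congr horner.
by apply: eq_map_poly => a /=; rewrite ji.
Qed.

Lemma adjoin_img t : adjoin i (j t) = img_set <<1; t>>%VS.
Proof.
apply/seteqP; split=> [_ [p [q ->]]|_ [x /= xt <-]].
  rewrite !horner_img -fmorph_div; eexists; last by []; rewrite /=.
  by rewrite rpred_div // mempx_Fadjoin ?memv_adjoin //;
     apply/polyOverP => k; rewrite coef_map memvZ ?mem1v.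
have [p pP ->] := Fadjoin_polyP xt.
have /polyOver1P[q ->] := pP.
exists q, 1; rewrite rmorph1 hornerC divr1 horner_img //.
Qed.

Lemma elt_degree_img t : elt_degree i (j t) = \dim <<1; t>>.
Proof. by rewrite /elt_degree adjoin_img ext_degree_img. Qed.

Lemma algebraic_img t : algebraicOver i (j t).
Proof.
have /polyOver1P[q qE] := minPolyOver 1 t.
exists q; first by rewrite -(map_poly_eq0 (in_alg L)) -qE monic_neq0 ?monic_minPoly.
by rewrite /root horner_img -qE minPolyxx rmorph0.
Qed.

Lemma map_minpoly t : map_poly (in_alg L) (minpoly i (j t)) = minPoly 1 t.
Proof.
have [mp irrp px] := minpolyP (algebraic_img t).
have /polyOver1P[q pE] := minPolyOver 1 t.
apply/eqP; rewrite -eqp_monic ?map_monic ?monic_minPoly //.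
apply/andP; split.
  rewrite pE dvdp_map -(irreducible_root_dvdp _ irrp px).
  by rewrite /root horner_img -pE minPolyxx rmorph0.
apply: minPoly_dvdp; last by rewrite /root -(fmorph_eq0 j) -horner_img.
by apply/polyOverP => k; rewrite coef_map memvZ ?mem1v.
Qed.

Lemma separable_minpoly_img t :
  separable_poly (minpoly i (j t)) = separable_element 1 t.
Proof. by rewrite /separable_element -map_minpoly separable_map. Qed.

Lemma size_minpoly_img t : size (minpoly i (j t)) = (\dim <<1; t>>).+1.
Proof.
by rewrite -(size_map_poly (in_alg L)) map_minpoly size_minPoly adjoin_degreeE
  dimv1 divn1.
Qed.

End Degree.

(** A basis of V generates a finite extension L, and V is the image of all of L, so a separable
    generator of L serves. A nonzero [ext_degree] guarantees that a basis exists. The intended V is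
    the residue field of K(a). *)
Lemma primitive_element (K E : fieldType) (i : {rmorphism K -> E}) (V : set E) :
  V 1 -> (forall x y, V x -> V y -> V (x * y)) ->
  separable_ext i V -> ext_degree i V != 0%N ->
  exists2 z, V z & size (minpoly i z) = (ext_degree i V).+1.
Proof.
move=> V1 VM Vsep; rewrite /ext_degree; case: xgetP => [n _ [b [bfree Vb]] _|_];
  last by rewrite eqxx.
have bV k : V (b k).
  rewrite Vb; exists (fun l => (l == k)%:R).
  rewrite (bigD1 k) //= eqxx rmorph1 mul1r big1 ?addr0 // => l /negPf ->.
  by rewrite rmorph0 mul0r.
have algb x : x \in codom b -> algebraicOver i x.
  by case/codomP => k ->; apply: separable_minpoly_algebraic; exact: Vsep.
have [L [j [ys [ji jys ysf]]]] := exists_extension_generated algb.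
have szys : size ys = n by rewrite -(size_map j) jys size_codom card_ord.
have jysk (k : 'I_n) : j ys`_k = b k.
  rewrite -(nth_map 0 0) ?szys // jys /codom.
  by rewrite (nth_map k) -?enumT ?size_enum_ord // nth_ord_enum.
have VE : V = img_set j <<ys>>%VS.
  rewrite Vb; apply/seteqP; split=> [_ [c ->]|_ [x /= xys <-]].
    exists (\sum_(k < n) c k *: ys`_k).
      by apply: memv_suml => k _; rewrite memvZ // memv_span // mem_nth ?szys.
    by rewrite rmorph_sum; apply: eq_bigr => k _; rewrite -mulr_algl rmorphM ji jysk.
  have szysE : size ys == n by rewrite szys.
  pose X := Tuple szysE.
  exists (fun k => coord X k x).
  rewrite {1}(coord_span (X := X) xys) rmorph_sum; apply: eq_bigr => k _.
  by rewrite -mulr_algl rmorphM ji jysk.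
have inV x : V (j x) -> x \in <<ys>>%VS.
  by rewrite VE => -[y yU /fmorph_inj <-].
have ofV x : x \in <<ys>>%VS -> V (j x) by rewrite VE => xU; exists x.
(* The span is a ring containing 1 and the generators of L, hence it is L. *)
have asp : is_aspace <<ys>>%VS.
  rewrite /is_aspace has_algid1; last by apply: inV; rewrite rmorph1.
  by apply/prodvP => x y xU yU; apply: inV; rewrite rmorphM; apply: VM; exact: ofV.
have ysfull : <<ys>>%VS = {:L}%VS.
  apply/eqP; rewrite eqEsubv subvf /= -ysf.
  apply/(@Fadjoin_seqP _ _ _ _ (ASpace asp)); split; last exact: memv_span.
  by rewrite sub1v.
rewrite ysfull in VE ofV.
have sepL : separable 1 {:L}.
  apply/separableP => x xL; rewrite -(separable_minpoly_img ji).
  by apply: Vsep; exact: ofV.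
have genL := eq_adjoin_separable_generator sepL (subvf _).
exists (j (separable_generator 1 {:L})); first by apply: ofV; rewrite memvf.
rewrite (size_minpoly_img ji) -genL; congr _.+1.
by apply: (is_basis_dim ji (b := b)); rewrite -VE.
Qed.

(** * Valuation inequalities and residue classes *)

Section Valuation.
Context (F : fieldType) (G : oagType) (w : valuation F G).
Implicit Types (x y : F) (g : extval G).

Lemma val_addge g x y : g <= w x -> g <= w y -> g <= w (x + y).
Proof. by move=> gx gy; apply: le_trans (valD w _ _); rewrite le_min gx. Qed.

Lemma val_addgt g x y : g < w x -> g < w y -> g < w (x + y).
Proof. by move=> gx gy; apply: lt_le_trans (valD w _ _); rewrite lt_min gx. Qed.

Lemma val_subge g x y : g <= w x -> g <= w y -> g <= w (x - y).
Proof. by move=> gx gy; apply: val_addge; rewrite ?valN. Qed.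

Lemma val_subgt g x y : g < w x -> g < w y -> g < w (x - y).
Proof. by move=> gx gy; apply: val_addgt; rewrite ?valN. Qed.

Lemma val_subC x y : w (x - y) = w (y - x).
Proof. by rewrite -valN opprB. Qed.

Lemma val_addl x y : w x < w y -> w (x + y) = w x.
Proof.
move=> xy; apply/le_anti; rewrite (val_addge (lexx _) (ltW xy)) andbT leNgt.
apply/negP => wlt; have := val_subgt wlt xy.
by rewrite addrK ltxx.
Qed.

Lemma val_sumge g (I : Type) (r : seq I) (P : pred I) (f : I -> F) :
  (forall k, P k -> g <= w (f k)) -> g <= w (\sum_(k <- r | P k) f k).
Proof.
move=> gf; apply: (big_ind (fun x => g <= w x)) => //.
  by rewrite val0; case: g {gf}.
by move=> x y; exact: val_addge.
Qed.

Lemma val_mulint g x y : Fin 0 <= w x -> g <= w y -> g <= w (x * y).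
Proof.
rewrite Defs.valM; case: (w x) => [|a|] //; case: (w y) => [|b|]; case: g => [|c|] //=.
rewrite !Fin_le => a0 cb; apply: le_trans cb _.
by have := oag_leD2r b a0; rewrite add0r.
Qed.

Lemma val_unit x : Fin 0 <= w x -> Fin 0 <= w x^-1 -> x != 0 -> w x = Fin 0.
Proof.
move=> x0 xV0 nx0; apply/le_anti; rewrite x0 andbT.
have := Defs.valM w x x^-1; rewrite divff // Defs.val1.
case: (w x) x0 => [|a|]; case: (w x^-1) xV0 => [|b|] //=.
rewrite !Fin_le => b0 a0 [ab].
by have := oag_leD2r a b0; rewrite add0r addrC -ab.
Qed.

Lemma val_unitV x : w x = Fin 0 -> w x^-1 = Fin 0.
Proof.
move=> x0; have nx0 : x != 0 by rewrite -(val_Pinfty w) x0.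
have := Defs.valM w x x^-1; rewrite divff // Defs.val1 x0.
by case: (w x^-1) => //= b; rewrite add0r.
Qed.

Lemma val_intV x : x != 0 -> (Fin 0 <= w x) || (Fin 0 <= w x^-1).
Proof.
move=> nx0; case: leP => //=.
have := Defs.valM w x x^-1; rewrite divff // Defs.val1.
have := val_Minfty w x; have := val_Minfty w x^-1.
case: (w x) => [|a|] // _; case: (w x^-1) => [|b|] //= _ -[ab].
rewrite Fin_lt Fin_le => a0.
case/orP: (oag_le_total 0 b) => // b0.
have := oag_leD2r a b0; rewrite add0r addrC -ab => a0'.
by rewrite (lt_geF a0) in a0'.
Qed.

(** The residue class as a total function on the field, with value 0 outside the valuation ring. *)
Definition res x : residue w := \pi_(residue w)%qT (insubd (0 : vring w) x).

Lemma res_val (u : vring w) : res (val u) = \pi_(residue w)%qT u.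
Proof. by rewrite /res valKd. Qed.

Lemma vintP x : Fin 0 <= w x -> exists u : vring w, x = val u.
Proof. by move=> x0; exists (Sub x x0); rewrite SubK. Qed.

Lemma resD x y : Fin 0 <= w x -> Fin 0 <= w y -> res (x + y) = res x + res y.
Proof.
by move=> /vintP[u ->] /vintP[t ->]; rewrite -rmorphD !res_val rmorphD.
Qed.

Lemma resM x y : Fin 0 <= w x -> Fin 0 <= w y -> res (x * y) = res x * res y.
Proof.
by move=> /vintP[u ->] /vintP[t ->]; rewrite -rmorphM !res_val rmorphM.
Qed.

Lemma res0 : res 0 = 0.
Proof. by rewrite -[0](rmorph0 (val : vring w -> F)) res_val rmorph0. Qed.

Lemma res1 : res 1 = 1.
Proof. by rewrite -[1](rmorph1 (val : vring w -> F)) res_val rmorph1. Qed.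

Lemma res_eq0 x : Fin 0 <= w x -> (res x == 0) = (Fin 0 < w x).
Proof. by move=> /vintP[u ->]; rewrite res_val residue_pi0. Qed.

Lemma res_eq x y : Fin 0 <= w x -> Fin 0 <= w y ->
  (res x == res y) = (Fin 0 < w (x - y)).
Proof.
move=> /vintP[u ->] /vintP[t ->].
by rewrite -rmorphB -residue_pi0 rmorphB subr_eq0 !res_val.
Qed.

Lemma res_sum (I : Type) (r : seq I) (P : pred I) (f : I -> F) :
  (forall k, P k -> Fin 0 <= w (f k)) ->
  res (\sum_(k <- r | P k) f k) = \sum_(k <- r | P k) res (f k).
Proof.
move=> f0; suff : Fin 0 <= w (\sum_(k <- r | P k) f k) /\
    res (\sum_(k <- r | P k) f k) = \sum_(k <- r | P k) res (f k) by case.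
apply: (big_ind2 (fun (x : F) (y : residue w) => Fin 0 <= w x /\ res x = y)).
- by rewrite val0 res0.
- move=> x1 x2 y1 y2 [x10 <-] [y10 <-]; rewrite resD //; split=> //.
  exact: val_addge.
- by move=> k Pk; rewrite f0.
Qed.

Lemma val_Xint x n : Fin 0 <= w x -> Fin 0 <= w (x ^+ n).
Proof.
by move=> x0; elim: n => [|n IH]; rewrite ?expr0 ?Defs.val1 // exprS val_mulint.
Qed.

Lemma resX x n : Fin 0 <= w x -> res (x ^+ n) = res x ^+ n.
Proof.
move=> x0; elim: n => [|n IH]; first by rewrite !expr0 res1.
by rewrite !exprS resM ?val_Xint // IH.
Qed.

Lemma res_surj (y : residue w) : exists2 x, Fin 0 <= w x & y = res x.
Proof.
exists (val (generic_quotient.repr y)); first exact: (valP (generic_quotient.repr y)).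
by rewrite res_val reprK.
Qed.

End Valuation.

(** * The morphism of residue fields induced by an extension *)

Section ResidueMap.
Context (F E : fieldType) (G : oagType) (f : {rmorphism F -> E}).
Context (v : valuation F G) (w : valuation E G).
Hypothesis wf : forall x, w (f x) = v x.

(** The representative chosen by [residue_map] differs from x by an element of positive value, and f
    preserves values. *)
Lemma residue_map_res x : Fin 0 <= v x -> residue_map f w (res v x) = res w (f x).
Proof.
move=> x0; rewrite /residue_map -/(res w _).
have y0 : Fin 0 <= v (val (generic_quotient.repr (res v x))).
  exact: (valP (generic_quotient.repr (res v x))).
apply/eqP; rewrite res_eq ?wf // -rmorphB wf -res_eq //.
by rewrite res_val reprK.
Qed.

Lemma residue_map_zmod : zmod_morphism (residue_map (v := v) f w).
Proof.
move=> x y; have [a a0 ->] := res_surj x; have [b b0 ->] := res_surj y.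
have b0' : Fin 0 <= v (- b) by rewrite valN.
have resN : - res v b = res v (- b).
  by apply/eqP; rewrite eq_sym -subr_eq0 opprK -resD // addNr res0.
rewrite resN -resD // !residue_map_res ?val_addge // rmorphD rmorphN resD ?wf //;
  last by rewrite -rmorphN wf.
congr (_ + _); apply/eqP; rewrite -subr_eq0 opprK -resD ?addNr ?res0 ?wf //.
by rewrite -rmorphN wf.
Qed.

Lemma residue_map_monoid : monoid_morphism (residue_map (v := v) f w).
Proof.
split=> [|x y].
  by rewrite -(res1 v) residue_map_res ?Defs.val1 // rmorph1 res1.
have [a a0 ->] := res_surj x; have [b b0 ->] := res_surj y.
by rewrite -resM // !residue_map_res ?val_mulint // rmorphM resM ?wf.
Qed.

Definition residue_mor : {rmorphism residue v -> residue w} :=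
  HB.pack (residue_map (v := v) f w)
    (GRing.isZmodMorphism.Build _ _ _ residue_map_zmod)
    (GRing.isMonoidMorphism.Build _ _ _ residue_map_monoid).

Lemma residue_mor_res x : Fin 0 <= v x -> residue_mor (res v x) = res w (f x).
Proof. exact: residue_map_res. Qed.

End ResidueMap.

(** * Invariance of the valuation under Galois automorphisms *)

Section GaloisInvariance.
Context (K : fieldType) (G : oagType) (v : valuation K G) (v_hens : henselian v).
Context (M : splittingFieldType K) (w : valuation M G).
Hypothesis wv : forall a : K, w a%:A = v a.
Context (s : gal_of {:M}).

Definition gal_val : valuation M G.
Proof.
by refine (@Valuation M G (fun x => w (s x)) _ _ _ _) => [x|x|x y|x y];
  rewrite ?val_Minfty ?val_Pinfty ?fmorph_eq0 ?rmorphM ?rmorphD ?Defs.valM ?valD.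
Defined.

Lemma gal_int x : (Fin 0 <= w (s x)) = (Fin 0 <= w x).
Proof.
have alg (z : M) : algebraicOver (in_alg M) z.
  exact: (@algebraic_img K M (in_alg M) M (idfun : {rmorphism M -> M}) _ z).
have p1 : prolongs (in_alg M) v w by move=> a; rewrite /= wv.
have p2 : prolongs (in_alg M) v gal_val by move=> a; rewrite /= rmorph_alg wv.
by rewrite (v_hens alg p1 p2 x).
Qed.

(* [henselian] only compares valuation rings: [s u / u] could be integral with  *)
(* non-integral inverse, but [u / s u] is a product of conjugates of [s u / u].*)
Lemma gal_val_inv x : w (s x) = w x.
Proof.
have [->|nx0] := eqVneq x 0; first by rewrite rmorph0.
have key u : u != 0 -> Fin 0 <= w (s u / u) -> Fin 0 <= w (u / s u).
  move=> nu0 u0.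
  have pow k (y : M) : Fin 0 <= w y -> Fin 0 <= w ((s ^+ k)%g y).
    elim: k y => [|k IH] y y0; first by rewrite gal_id.
    by rewrite expgSr galM ?memvf // gal_int IH.
  (* The quotient is a telescoping product of conjugates of [s u / u]; once k.+1 is the order of s,
     it is [u / s u]. *)
  have step k : Fin 0 <= w ((s ^+ k.+1)%g u / s u).
    elim: k => [|k IH]; first by rewrite expg1 divff ?Defs.val1 ?fmorph_eq0.
    have -> : (s ^+ k.+2)%g u / s u =
        (s ^+ k.+1)%g (s u / u) * ((s ^+ k.+1)%g u / s u).
      have su : (s ^+ k.+1)%g (s u) = (s ^+ k.+2)%g u.
        by rewrite -galM ?memvf // -expgS.
      by rewrite fmorph_div /= su mulrA mulfVK ?fmorph_eq0.
    by apply: val_mulint IH; exact: pow.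
  have := step #[s]%g.-1; rewrite prednK ?order_gt0 // expg_order gal_id //.
(* One of [s x / x] and its inverse is integral; [key] at x or at [x^-1] makes the other integral
   too. *)
have unit_w : w (s x / x) = Fin 0.
  have ny : s x / x != 0 by rewrite mulf_neq0 ?invr_eq0 ?fmorph_eq0.
  have yV : (s x / x)^-1 = x / s x by rewrite invf_div.
  apply: val_unit => //.
    case/orP: (val_intV w ny) => //; rewrite yV => x0.
    have := key x^-1; rewrite invr_eq0 fmorphV !invrK mulrC [x^-1 * _]mulrC.
    exact.
  case/orP: (val_intV w ny) => // x0; rewrite yV; exact: key.
rewrite -[s x](mulfVK nx0) Defs.valM unit_w.
by have [g ->] := val_finP w nx0; rewrite /= add0r.
Qed.

End GaloisInvariance.

(** * Subgroups of the Galois group cut out by the valuation, and residues of conjugates *)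

Section GaloisValuation.
Context (K : fieldType) (G : oagType) (v : valuation K G) (v_hens : henselian v).
Context (E : fieldType) (i : {rmorphism K -> E}) (w : valuation E G).
Hypothesis wi : forall a : K, w (i a) = v a.
Context (M : splittingFieldType K) (j : {rmorphism M -> E}).
Hypothesis ji : forall a : K, j a%:A = i a.
Hypothesis gal_M : galois 1 {:M}.
Implicit Types (s t : gal_of {:M}) (a x y z : M) (d : extval G).

Local Notation Gal := ('Gal({:M} / 1))%g.
Local Notation rho x := (res w (j x)).
Context (kappa : {rmorphism residue v -> residue w}).
Hypothesis kappaE : forall a : K, Fin 0 <= v a -> kappa (res v a) = res w (i a).

Definition pull_val : valuation M G.
Proof.
by refine (@Valuation M G (fun x => w (j x)) _ _ _ _) => [x|x|x y|x y];
  rewrite ?val_Minfty ?val_Pinfty ?fmorph_eq0 ?rmorphM ?rmorphD ?Defs.valM ?valD.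
Defined.

Lemma val_gal_embed s x : w (j (s x)) = w (j x).
Proof.
by apply: (@gal_val_inv _ _ _ v_hens _ pull_val) => a; rewrite /= ji wi.
Qed.

Lemma Hbar_group_set d x : group_set (Hbar_group w j x d).
Proof.
apply/group_setP; split=> [|s t].
  by rewrite inE group1 gal_id subrr val0; case: d.
rewrite !inE => /andP[sG ds] /andP[tG dt]; rewrite groupM //=.
rewrite galM ?memvf //.
have -> : j x - j (t (s x)) = (j x - j (t x)) + j (t (x - s x)).
  by rewrite !rmorphB addrA subrK.
by rewrite val_addge // val_gal_embed rmorphB.
Qed.
Canonical Hbar_grp d x := Group (Hbar_group_set d x).

(** The bound is taken finite because the strict inequality with bound [Pinfty] would define the
    empty set. *)
Lemma H_group_set g x : group_set (H_group w j x (Fin g)).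
Proof.
apply/group_setP; split=> [|s t]; first by rewrite inE group1 gal_id subrr val0.
rewrite !inE => /andP[sG ds] /andP[tG dt]; rewrite groupM //=.
rewrite galM ?memvf //.
have -> : j x - j (t (s x)) = (j x - j (t x)) + j (t (x - s x)).
  by rewrite !rmorphB addrA subrK.
by rewrite val_addgt // val_gal_embed rmorphB.
Qed.
Canonical H_grp g x := Group (H_group_set g x).

Lemma stab_subset a x (A : {set gal_of {:M}}) :
  x \in <<1; a>>%VS ->
  (forall t, t \in Gal -> t x = x -> t \in A) -> 'Gal({:M} / <<1; a>>)%g \subset A.
Proof.
move=> xa AP; apply/subsetP => t tS.
have tG : t \in Gal by apply: subsetP tS; apply: galS; exact: sub1v.
by apply: AP => //; apply: fixed_gal tS _ => //; exact: subvf.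
Qed.

(** The coefficients are lifted. A single q serves all integral y, so it can be evaluated at all
    conjugates of an element. *)
Lemma res_horner (p : {poly residue v}) :
  exists q : {poly K}, forall y, Fin 0 <= w (j y) ->
    Fin 0 <= w (j (map_poly (in_alg M) q).[y]) /\
    rho (map_poly (in_alg M) q).[y] = (map_poly kappa p).[rho y].
Proof.
elim/poly_ind: p => [|p c [q qP]].
  by exists 0 => y _; rewrite !rmorph0 !horner0 rmorph0 val0 res0.
have [b b0 ->] := res_surj c.
exists (q * 'X + b%:P) => y y0; have [q0 qE] := qP y y0.
rewrite !rmorphD !rmorphM /= !map_polyX !map_polyC /= !hornerMXaddC.
have wb : Fin 0 <= w (i b) by rewrite wi.
rewrite !rmorphD !rmorphM /= ji resD ?val_mulint // resM // qE.
by rewrite val_addge ?val_mulint // kappaE.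
Qed.

Section ResidueGenerator.
Variables (z : M) (h : {poly residue v}).
Hypotheses (z0 : Fin 0 <= w (j z)) (h_irr : irreducible_poly h)
  (h_sep : separable_poly h) (hz : root (map_poly kappa h) (rho z)).

Local Notation T := (H_group w j z (Fin 0)).

Lemma gal_int0 s x : Fin 0 <= w (j x) -> Fin 0 <= w (j (s x)).
Proof. by rewrite val_gal_embed. Qed.

(** If q over K lifts h, then q(z) has positive value, and so has q(t z) = t (q(z)). *)
Lemma root_res_gal t : root (map_poly kappa h) (rho (t z)).
Proof.
have [q qP] := res_horner h.
have [q0 qE] := qP z z0; have [tq0 tqE] := qP _ (gal_int0 t z0).
have tq : (map_poly (in_alg M) q).[t z] = t (map_poly (in_alg M) q).[z].
  rewrite -horner_map /= -map_poly_comp; congr (_.[_]).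
  by apply: eq_map_poly => a /=; rewrite rmorph_alg.
rewrite /root -tqE tq res_eq0 ?gal_int0 // val_gal_embed.
by rewrite -res_eq0 // qE; exact: hz.
Qed.

(** The product of the X - t z is Galois invariant with integral coefficients, so it reduces to a
    polynomial over the residue field of K. This reduction vanishes at the residue of z, so the
    irreducible h divides it. *)
Lemma dvdp_res_conj :
  map_poly kappa h %| \prod_(t in Gal) ('X - (rho (t z))%:P).
Proof.
pose P : {poly M} := \prod_(t in Gal) ('X - (t z)%:P).
pose u t : vring w := insubd 0 (j (t z)).
have [vl vlE] : exists f : {rmorphism vring w -> E}, f =1 val by exists val.
have [pr prE] : exists f : {rmorphism vring w -> residue w},
    forall b : vring w, f b = res w (val b).
  by exists (\pi_(residue w))%qT => x; rewrite res_val.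
have uE t : vl (u t) = j (t z).
  by rewrite vlE /u; have [y yE] := vintP (gal_int0 t z0); rewrite yE valKd.
(* Q is P with coefficients in the valuation ring, where the residue projection [pr] is a ring
   morphism. *)
pose Q := \prod_(t in Gal) ('X - (u t)%:P).
have QP : map_poly vl Q = map_poly j P.
  rewrite !rmorph_prod; apply: eq_bigr => t _.
  by rewrite !rmorphB /= !map_polyX !map_polyC /= uE.
have QR : map_poly pr Q = \prod_(t in Gal) ('X - (rho (t z))%:P).
  rewrite rmorph_prod; apply: eq_bigr => t _.
  by rewrite !rmorphB /= !map_polyX !map_polyC /= prE -vlE uE.
have fixP t : t \in Gal -> map_poly t P = P.
  move=> tG; rewrite rmorph_prod /= [RHS](reindex_inj (mulIg t)) /=.
  apply: eq_big => s; first by rewrite groupMr.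
  by move=> _; rewrite rmorphB /= map_polyX map_polyC /= galM ?memvf.
have /polyOver1P[p PE] : P \is a polyOver 1%VS.
  apply/polyOverP => k; rewrite -(galois_fixedField gal_M).
  apply/fixedFieldP => [|t tG]; first exact: memvf.
  by rewrite -{2}(fixP t tG) coef_map.
have Qk k : vl Q`_k = i p`_k by rewrite -coef_map QP PE coef_map coef_map /= ji.
have pk k : Fin 0 <= v p`_k by rewrite -wi -Qk vlE; exact: (valP Q`_k).
have RE : \prod_(t in Gal) ('X - (rho (t z))%:P) =
          map_poly kappa (\poly_(k < size p) res v p`_k).
  rewrite -QR; apply/polyP => k; rewrite !coef_map coef_poly /=.
  rewrite prE -vlE Qk; case: ltnP => kp; first by rewrite kappaE.
  by rewrite nth_default // rmorph0 res0 rmorph0.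
rewrite RE dvdp_map -(irreducible_root_dvdp _ h_irr hz) -RE.
rewrite (bigD1 1%g) ?group1 //= gal_id rootM; apply/orP; left.
by rewrite root_XsubC.
Qed.

Lemma res_conj_eq s t : s \in Gal -> t \in Gal ->
  (rho (s z) == rho (t z)) = ((s * t^-1)%g \in T).
Proof.
move=> sG tG; rewrite res_eq ?gal_int0 // inE groupM ?groupV //=.
rewrite -rmorphB -(val_gal_embed t^-1%g) rmorphB /= -!galM ?memvf // mulgV gal_id.
by rewrite rmorphB val_subC.
Qed.

(** Orbit-stabiliser: the cosets of T correspond to the distinct residues of conjugates of z, and
    these are exactly the roots of the separable polynomial h. *)
Lemma index_res_stab : #|Gal : T|%g = (size h).-1.
Proof.
have TG : T \subset Gal by apply/subsetP => t; rewrite inE => /andP[].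
pose c (C : {set gal_of {:M}}) := rho (repr C z).
have reprG C : C \in rcosets T Gal -> repr C \in Gal.
  case/rcosetsP => t tG ->; have := mem_repr_rcoset (H_grp 0 z) t.
  by case/rcosetP => u uT ->; rewrite groupM // (subsetP TG).
have cinj : {in rcosets T Gal &, injective c}.
  move=> C D CR DR /eqP; rewrite /c res_conj_eq ?reprG // => CD.
  case/rcosetsP: CR CD => s sG ->; case/rcosetsP: DR => t tG -> CD.
  have /rcosetP[s' s'T es] := mem_repr_rcoset (H_grp 0 z) s.
  have /rcosetP[t' t'T et] := mem_repr_rcoset (H_grp 0 z) t.
  apply/(@rcoset_eqP _ (H_grp 0 z)); rewrite mem_rcoset.
  move: CD; rewrite es et invMg mulgA -(mulgA s') => CD.
  rewrite -(groupMl _ s'T) -(groupMr _ (groupVr t'T)) //.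
pose cs := [seq c C | C <- enum (rcosets T Gal)].
have ucs : uniq cs.
  rewrite map_inj_in_uniq ?enum_uniq // => C D; rewrite !mem_enum.
  exact: cinj.
have szcs : size cs = #|Gal : T|%g by rewrite size_map -cardE.
have nzh : map_poly kappa h != 0 by rewrite map_poly_eq0 irredp_neq0.
apply/eqP; rewrite -szcs eqn_leq; apply/andP; split.
  have : all (root (map_poly kappa h)) cs.
    by apply/allP => _ /mapP[C _ ->]; exact: root_res_gal.
  move/(max_poly_roots nzh); rewrite size_map_poly => /(_ ucs) lt.
  by rewrite -ltnS prednK // (leq_ltn_trans (leq0n _) lt).
(* Up to a unit, h is the product of X - b over a sublist of the conjugate residues. Separability
   makes its entries distinct, and each is the value of [c] at some coset. *)
have := dvdp_res_conj; rewrite -big_enum.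
rewrite -(big_map (fun t => rho (t z)) predT (fun b => 'X - b%:P)).
move=> /dvdp_prod_XsubC[m hm].
have : separable_poly (map_poly kappa h) by rewrite separable_map.
rewrite (eqp_separable hm) separable_prod_XsubC => um.
rewrite -(size_map_poly kappa) (eqp_size hm) size_prod_XsubC /=.
apply: uniq_leq_size => // b /mem_mask /mapP[t]; rewrite mem_enum => tG ->.
apply/mapP; exists (T :* t)%g; first by rewrite mem_enum mem_rcosets mulSGid // mem_rcoset.
have /rcosetP[t' t'T et] := mem_repr_rcoset (H_grp 0 z) t.
apply/eqP; rewrite eq_sym /c res_conj_eq ?et ?mulgK //.
by rewrite groupM // (subsetP TG).
Qed.

End ResidueGenerator.
End GaloisValuation.

(** If all power sums vanished, so would the sum of q(f k) for every polynomial q. For q vanishing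
    at all values of f on A except x, that sum is q(x) times the number of k with f k = x. *)
Lemma exists_power_sum_neq0 (F : fieldType) (I : finType) (A : {set I})
    (f : I -> F) (x : F) :
  #|[set k in A | f k == x]|%:R != 0 :> F ->
  exists n, \sum_(k in A) f k ^+ n != 0.
Proof.
move=> card0; apply: contrapT => /forallNP sum0.
move/negP: card0; apply.
have sum_horner p : \sum_(k in A) p.[f k] = 0.
  under eq_bigr do rewrite horner_coef.
  rewrite exchange_big big1 // => n _; rewrite -mulr_sumr.
  by have /negP := sum0 n; rewrite negbK => /eqP ->; rewrite mulr0.
pose rs := [seq y <- [seq f k | k in A] | y != x].
pose q := \prod_(y <- rs) ('X - y%:P).
have qx : q.[x] != 0.
  apply/negP => /= qx0; have : root q x := qx0.
  by rewrite root_prod_XsubC mem_filter eqxx.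
have := sum_horner q; rewrite (bigID (fun k => f k == x)) /=.
rewrite [X in _ + X]big1 ?addr0 => [|k /andP[kA kx]]; last first.
  by apply/rootP; rewrite root_prod_XsubC mem_filter kx; apply: image_f.
rewrite (eq_bigr (fun=> q.[x])) => [|k /andP[_ /eqP ->] //].
rewrite (eq_bigl (fun k => k \in [set k in A | f k == x])) => [|k]; last by rewrite inE.
by rewrite sumr_const => /eqP; rewrite -(mulr_natr q.[x]) mulf_eq0 (negPf qx).
Qed.

(** * What tameness provides: a residue generator, and e invertible in the residue field *)

Section TameData.
Context (K : fieldType) (G : oagType) (v : valuation K G).
Context (E : fieldType) (i : {rmorphism K -> E}) (w : valuation E G).
Hypothesis wi : forall a : K, w (i a) = v a.
Context (M : fieldExtType K) (j : {rmorphism M -> E}).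
Hypothesis ji : forall a : K, j a%:A = i a.

Lemma residue_set_res (V : set E) (y : residue w) :
  residue_set (w := w) V y <-> exists2 x, V x /\ Fin 0 <= w x & y = res w x.
Proof.
split=> [[x Vx ->]|[x [Vx /vintP[u xu]] ->]].
  by exists (val x); [split; [|exact: (valP x)] | rewrite res_val].
by exists u; rewrite -?xu // xu res_val.
Qed.

Lemma tame_residue_generator (a : M) :
  tame_elt i v w (j a) ->
  exists (z : M) (h : {poly residue v}) (e : nat),
    [/\ z \in <<1; a>>%VS, Fin 0 <= w (j z), irreducible_poly h, separable_poly h
      & root (map_poly (residue_mor wi) h) (res w (j z))] /\
    (\dim <<1; a>> = e * (size h).-1)%N /\
    (forall d, (d %| e)%N -> d%:R != 0 :> residue w).
Proof.
case=> _; rewrite /defectless_ext /has_defect -/(elt_degree i (j a)).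
rewrite (elt_degree_img ji) muln1.
set V := adjoin i (j a); set e := ramification_index _ _ _.
set f := inertia_degree _ _ _ _.
move=> dimE Vsep etame.
(* Hence neither e nor f is the default 0 that stands for an infinite value. *)
have ef0 : (0 < e * f)%N by rewrite -dimE adim_gt0.
have VE : V = img_set j <<1; a>>%VS by exact: adjoin_img.
have W1 : residue_set (w := w) V 1.
  apply/residue_set_res; exists 1; last by rewrite res1.
  by split; [rewrite VE; exists 1; rewrite ?rmorph1 //=; exact: mem1v | rewrite Defs.val1].
have WM x y : residue_set (w := w) V x -> residue_set (w := w) V y ->
    residue_set (w := w) V (x * y).
  move=> /residue_set_res[b [Vb b0] ->] /residue_set_res[c [Vc c0] ->].
  apply/residue_set_res; exists (b * c); last by rewrite resM.
  split; last exact: val_mulint.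
  move: Vb Vc; rewrite VE => -[b' b'V <-] [c' c'V <-].
  by exists (b' * c'); rewrite ?rmorphM //=; exact: rpredM.
have f0 : ext_degree (residue_mor wi) (residue_set (w := w) V) != 0%N.
  by rewrite -lt0n; move: ef0; rewrite muln_gt0 => /andP[].
have [y Wy szy] := primitive_element (i := residue_mor wi) W1 WM Vsep f0.
have sepy : separable_poly (minpoly (residue_mor wi) y) by exact: Vsep.
have [_ irry rooty] := minpolyP (separable_minpoly_algebraic sepy).
case/residue_set_res: Wy => x [Vx x0] yx.
move: Vx; rewrite VE => -[z zV zx].
exists z, (minpoly (residue_mor wi) y), e; rewrite zx -yx szy; split=> //.
split=> // d de.
have d0 : (0 < d)%N by apply: dvdn_gt0 de; move: ef0; rewrite muln_gt0 => /andP[].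
rewrite -(rmorph_nat (residue_mor wi)) fmorph_eq0; apply/negP.
move=> d00; have [p pch] := natf0_pchar d0 d00.
by have := etame p pch; rewrite (dvdn_trans _ de) // (dvdn_pcharf pch) d00.
Qed.

End TameData.

(** * Approximating a tame element by elements of smaller degree *)

Section TameApproximation.
Context (K : fieldType) (G : oagType) (v : valuation K G) (v_hens : henselian v).
Context (E : fieldType) (i : {rmorphism K -> E}) (w : valuation E G).
Hypothesis wi : forall a : K, w (i a) = v a.
Context (M : splittingFieldType K) (j : {rmorphism M -> E}).
Hypothesis ji : forall a : K, j a%:A = i a.
Hypothesis gal_M : galois 1 {:M}.
Implicit Types (s t : gal_of {:M}) (a x y z : M).

Local Notation Gal := ('Gal({:M} / 1))%g.
Local Notation rho x := (res w (j x)).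
Local Notation repr_act C := (repr C : gal_of {:M}).

(** When H contains Gal(M/K(a)), the sum is the trace of y from K(a) to the fixed field of H. In
    general, right multiplication by t permutes the cosets. *)
Lemma rcosets_sum_fixed (a y : M) (H : {group gal_of {:M}}) t :
  y \in <<1; a>>%VS -> t \in H ->
  t (\sum_(C in rcosets 'Gal({:M} / <<1; a>>) H) repr_act C y)
    = \sum_(C in rcosets 'Gal({:M} / <<1; a>>) H) repr_act C y.
Proof.
move=> ya tH; rewrite rmorph_sum /=.
pose act (C : {set gal_of {:M}}) := (C :* t)%g.
have act_inj : injective act by move=> C D /(can_inj (rcosetK t)).
have actH C : (act C \in rcosets 'Gal({:M} / <<1; a>>) H)
    = (C \in rcosets 'Gal({:M} / <<1; a>>) H).
  apply/rcosetsP/rcosetsP => -[s sH CE].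
    exists (s * t^-1)%g; first by rewrite groupM ?groupV.
    by rewrite rcosetM -CE /act rcosetK.
  by exists (s * t)%g; rewrite ?groupM // rcosetM -CE.
rewrite [RHS](reindex_inj act_inj) /=; apply: eq_big => [C|C CR].
  by rewrite actH.
have fixy (s u : gal_of {:M}) : s \in ('Gal({:M} / <<1; a>>) :* u)%g -> s y = u y.
  case/rcosetP => s' s'S ->; rewrite galM ?memvf //.
  by rewrite (fixed_gal _ s'S ya) ?subvf.
case/rcosetsP: CR => s sH ->.
rewrite /act -rcosetM (fixy _ _ (mem_repr_rcoset _ s)).
by rewrite (fixy _ _ (mem_repr_rcoset _ (s * t))) galM ?memvf.
Qed.

(** The witness is an average of conjugates of a under H with integral weights of unit sum, so it is
    as close to a as they are. It is fixed by H, which strictly contains the stabiliser of a, and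
    this lowers the degree. *)
Lemma tame_approximation (a : M) s :
  tame_elt i v w (j a) -> s \in Gal -> s a != a ->
  exists2 b : M, (\dim <<1; b>> < \dim <<1; a>>)%N &
    w (j a - j (s a)) <= w (j a - j b).
Proof.
move=> tame_a sG sa.
have [z [h [e [[za z0 irrh seph hz] [dima e_unit]]]]] :=
  tame_residue_generator wi ji tame_a.
pose d := w (j a - j (s a)).
pose S := 'Gal({:M} / <<1; a>>)%G.
pose H := Hbar_grp v_hens wi ji d a.
pose T := H_grp v_hens wi ji 0 z.
have HG : H \subset Gal by apply/subsetP => t; rewrite inE => /andP[].
have SH : S \subset H.
  apply: stab_subset (memv_adjoin _ _) _ => t tG ta.
  by rewrite inE tG ta subrr val0 /=; case: (d).
have ST : S \subset T.
  by apply: stab_subset za _ => t tG tz; rewrite inE tG tz subrr val0.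
have TG : T \subset Gal by apply/subsetP => t; rewrite inE => /andP[].
have SG : S \subset Gal := subset_trans SH HG.
have sH : s \in H by rewrite inE sG /=.
have sNS : s \notin S.
  apply: contra sa => sS; apply/eqP.
  by apply: fixed_gal sS (memv_adjoin _ _); exact: subvf.
have galF : galois <<1; a>> {:M}.
  by apply: galoisS gal_M; rewrite sub1v subvf.
have cardS : (#|S| * \dim <<1; a>> = \dim {:M})%N.
  by rewrite -(galois_dim galF) -dim_sup_field ?subvf.
have cardG : #|Gal| = \dim {:M} by rewrite -(galois_dim gal_M) dimv1 divn1.
have idxGS : #|Gal : S|%g = \dim <<1; a>>.
  by rewrite -divgS // cardG -cardS mulKn ?cardG_gt0.
(* Defectlessness gives [Gal : S] = e f, while [Gal : T] = f. *)
have idxTS : #|T : S|%g = e.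
  have h0 : (0 < (size h).-1)%N by case: irrh => h1 _; rewrite -subn1 subn_gt0.
  apply/eqP; rewrite -(eqn_pmul2r h0) -dima -idxGS -(Lagrange_index TG ST).
  rewrite mulnC; apply/eqP; congr (_ * _)%N.
  by rewrite (index_res_stab v_hens wi ji gal_M (residue_mor_res wi) z0 irrh).
have idxHTS : (#|H :&: T : S|%g %| e)%N.
  rewrite -idxTS -(Lagrange_index (subsetIr H T) _) ?dvdn_mull //.
  by rewrite subsetI SH ST.
pose R := rcosets S H.
have reprH (C : {set gal_of {:M}}) : C \in R -> repr C \in H.
  case/rcosetsP => t tH ->; have /rcosetP[u uS ->] := mem_repr_rcoset S t.
  by rewrite groupM // (subsetP SH).
(* The cosets sending z into its own residue class are those contained in T. *)
have cardR : #|[set C in R | rho (repr_act C z) == rho z]| = #|H :&: T : S|%g.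
  congr #|pred_of_set _|; apply/setP => C; rewrite inE.
  have zE t : t \in H -> (rho (t z) == rho z) = (t \in T).
    have z1 : (1 : gal_of {:M})%g z = z by exact: gal_id.
    move=> tH; rewrite -{2}z1 (res_conj_eq v_hens wi ji z0) ?group1 ?(subsetP HG) //.
    by rewrite invg1 mulg1.
  apply/andP/rcosetsP => [[CR]|[t]].
    rewrite zE ?reprH // => CT.
    have [t tH Ct] := rcosetsP CR; exists t => //.
    rewrite inE tH /=; move: CT; rewrite Ct.
    by have /rcosetP[u uS ->] := mem_repr_rcoset S t; rewrite groupMl // (subsetP ST).
  rewrite inE => /andP[tH tT] ->.
  have CR : (S :* t)%g \in R by apply/rcosetsP; exists t.
  rewrite zE ?reprH //; split=> //.
  by have /rcosetP[u uS ->] := mem_repr_rcoset S t; rewrite groupM // (subsetP ST).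
have [n sum_n] : exists n, \sum_(C in R) rho (repr_act C z) ^+ n != 0.
  by apply: (exists_power_sum_neq0 (x := rho z)); rewrite cardR e_unit.
pose u := z ^+ n.
have uF : u \in <<1; a>>%VS by exact: rpredX.
have u0 t : Fin 0 <= w (j (t u)).
  by rewrite (val_gal_embed v_hens wi ji) rmorphXn val_Xint.
pose sum (y : M) := \sum_(C in R) repr_act C y.
have sum_u : w (j (sum u)) = Fin 0.
  apply/le_anti; rewrite rmorph_sum val_sumge ?andbT => [|C _]; last exact: u0.
  rewrite leNgt -res_eq0; last by apply: val_sumge => C _; exact: u0.
  rewrite res_sum => [|C _]; last exact: u0.
  rewrite (eq_bigr (fun C => rho (repr_act C z) ^+ n)) // => C _.
  by rewrite !rmorphXn resX // (val_gal_embed v_hens wi ji).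
have nsum_u : sum u != 0.
  by rewrite -(fmorph_eq0 j) -(val_Pinfty w) sum_u.
pose b := sum (u * a) / sum u.
exists b.
  have bH : b \in fixedField H.
    apply/fixedFieldP => [|t tH]; first exact: memvf.
    by rewrite fmorph_div /= !rcosets_sum_fixed // rpredM ?memv_adjoin.
  have dimb : (\dim <<1; b>> <= \dim (fixedField H))%N.
    by apply/dimvS/FadjoinP; split; [exact: sub1v|].
  apply: leq_ltn_trans dimb _.
  have dimH : (#|H| * \dim (fixedField H) = \dim {:M})%N.
    by rewrite (dim_fixedField H) -dim_sup_field ?subvf.
  have SltH : (#|S| < #|H|)%N.
    by apply: proper_card; rewrite properE SH; apply/subsetPn; exists s.
  rewrite -(ltn_pmul2l (cardG_gt0 H)) dimH -cardS ltn_pmul2r //.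
  exact: adim_gt0.
(* The weights add up to [sum u], so a itself is the weighted average of the constant a. *)
have -> : j a - j b = j ((sum u)^-1) * j (\sum_(C in R) repr_act C u *
    (a - repr_act C a)).
  rewrite -rmorphB -rmorphM; congr (j _); rewrite /b.
  under eq_bigr do rewrite mulrBr -rmorphM /=.
  rewrite sumrB -mulr_suml -/(sum u) mulrBr mulrA mulVf // mul1r.
  by rewrite [X in _ - X]mulrC.
apply: val_mulint; first by rewrite fmorphV val_unitV.
rewrite rmorph_sum; apply: val_sumge => C CR.
rewrite rmorphM rmorphB; apply: val_mulint; first exact: u0.
by have := reprH _ CR; rewrite inE => /andP[].
Qed.

End TameApproximation.

(** * A common Galois extension, and the comparison with the Okutsu sequence *)

(** M is generated by all roots of the product p of the minimal polynomials, hence is a splitting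
    field of p. Each root shares its minimal polynomial with some entry of xs, hence is
    separable. *)
Lemma exists_galois_extension (K : fieldType) (E : closedFieldType)
    (i : {rmorphism K -> E}) (xs : seq E) :
  (forall x, x \in xs -> separable_poly (minpoly i x)) ->
  exists (M : splittingFieldType K) (j : {rmorphism M -> E}),
    [/\ forall a : K, j a%:A = i a, galois 1 {:M}
      & forall x, x \in xs -> exists t, j t = x].
Proof.
move=> sepxs.
have algxs x : x \in xs -> algebraicOver i x.
  by move/sepxs; exact: separable_minpoly_algebraic.
pose p := \prod_(x <- xs) minpoly i x.
have mp : p \is monic.
  by rewrite /p big_seq; apply: monic_prod => x /algxs /minpolyP[].
have [rs prs] := closed_field_poly_normal (map_poly i p).
have lcp : lead_coef (map_poly i p) = 1 by apply/eqP; rewrite -monicE map_monic.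
rewrite {}lcp scale1r in prs.
have rootrs y : y \in rs -> exists2 x, x \in xs & root (map_poly i (minpoly i x)) y.
  rewrite -root_prod_XsubC -prs rmorph_prod /root horner_prod prodf_seq_eq0.
  by case/hasP => x xxs /= xy; exists x.
have algrs y : y \in rs -> algebraicOver i y.
  case/rootrs => x /algxs /minpolyP[_ /irredp_neq0 nz _] xy.
  by exists (minpoly i x).
have [L [j [ys [ji jys ysf]]]] := exists_extension_generated algrs.
have splitL : splitting_field_axiom L.
  exists (map_poly (in_alg L) p).
    by apply/polyOverP => k; rewrite coef_map memvZ ?mem1v.
  exists ys => //; rewrite -(eqp_map j) -map_poly_comp (eq_map_poly (ji : _ \o _ =1 _)).
  rewrite prs -jys big_map rmorph_prod /=.
  under [X in _ %= X]eq_bigr do rewrite rmorphB /= map_polyX map_polyC /=.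
  exact: eqpxx.
pose M : splittingFieldType K :=
  HB.pack (FieldExt.sort L) (FieldExt_isSplittingField.Build K L splitL).
exists M, (j : {rmorphism M -> E}); split=> //.
  rewrite /galois sub1v normalFieldf andbT /= -[fullv](ysf : _ = {:M}%VS).
  apply: separable_Fadjoin_seq; apply/allP => y yys.
  rewrite -(@separable_minpoly_img _ _ i M (j : {rmorphism M -> E}) ji).
  have [x xxs xy] : exists2 x, x \in xs & root (map_poly i (minpoly i x)) (j y).
    by apply: rootrs; rewrite -jys map_f.
  have [mx ix _] := minpolyP (algxs _ xxs).
  have [my iy jy] := minpolyP (algebraic_img ji y).
  by rewrite -(irreducible_root_uniq mx my ix iy xy jy) sepxs.
move=> x xxs; have : x \in rs.
  rewrite -root_prod_XsubC -prs rmorph_prod /root horner_prod prodf_seq_eq0.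
  apply/hasP; exists x => //=; have [_ _] := minpolyP (algxs _ xxs).
  by rewrite /root.
by rewrite -jys => /mapP[y _ ->]; exists y.
Qed.

Theorem corollary4p3
  (K : fieldType) (G : oagType) (v : valuation K G) (v_hens : henselian v)
  (Kbar : closedFieldType) (iota : {rmorphism K -> Kbar})
  (Kbar_alg : forall z : Kbar, algebraicOver iota z)
  (vbar : valuation Kbar G) (vbar_ext : forall x : K, vbar (iota x) = v x)
  (theta : Kbar)
  (theta_sep : separable_elt iota theta)
  (theta_defectless : defectless_elt iota v vbar theta)
  (theta_deg : (1 < elt_degree iota theta)%N)
  (r : nat) (alpha : r.+1.-tuple Kbar)
  (alpha_okutsu : okutsu_sequence iota vbar theta alpha)
  (alpha_sep : forall i : nat, (i < r)%N -> separable_elt iota alpha`_i) :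
  (forall i : nat, (i <= r)%N ->
   forall (M : splittingFieldType K) (j : {rmorphism M -> Kbar}),
     (forall a : K, j a%:A = iota a) ->
     galois 1 {:M} ->
   forall t a : M, j t = theta -> j a = alpha`_i ->
     Hbar_group vbar j t (delta vbar theta alpha i)
       \subset H_group vbar j t (delta_pred vbar theta alpha i) /\
     (tame_elt iota v vbar alpha`_i ->
      H_group vbar j t (delta_pred vbar theta alpha i) =
      Hbar_group vbar j t (delta vbar theta alpha i))) /\
  (tame_elt iota v vbar theta ->
   exists2 d : extval G,
     is_main_invariant iota vbar theta d & is_krasner_constant iota vbar theta d).
Proof.
have [alpha_r deg0 deg_lt okutsu_le okutsu_lt] := alpha_okutsu.
have deg_mono k l : (k < l)%N -> (l <= r)%N ->
    (elt_degree iota alpha`_k < elt_degree iota alpha`_l)%N.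
  elim: l => // l IH; rewrite ltnS leq_eqVlt => /predU1P[->|kl] lr.
    exact: deg_lt.
  exact: ltn_trans (IH kl (ltnW lr)) (deg_lt _ lr).
have delta_lt k : (k < r)%N ->
    delta vbar theta alpha k < delta vbar theta alpha k.+1.
  move=> kr; rewrite /delta; have [kr1|] := ltnP k.+1 r.
    exact: okutsu_lt (deg_lt _ kr).
  (* At the last index the value is [Pinfty]; the earlier one is finite because the degrees
     distinguish its element from theta. *)
  move=> rk; have -> : k.+1 = r by apply/eqP; rewrite eqn_leq kr rk.
  rewrite alpha_r subrr val0 lt_neqAle; apply/andP; split; last by case: (vbar _).
  rewrite val_Pinfty subr_eq0; apply: contraTneq (deg_mono _ _ kr (leqnn _)) => <-.
  by rewrite alpha_r ltnn.
split.
  move=> i ir M j ji gal_M t a jt ja.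
  have delta_i : delta_pred vbar theta alpha i < delta vbar theta alpha i.
    case: i ir {ja} => [_|k kr]; last exact: delta_lt.
    by rewrite /= /delta lt_neqAle eq_sym val_Minfty.
  have HH : Hbar_group vbar j t (delta vbar theta alpha i)
      \subset H_group vbar j t (delta_pred vbar theta alpha i).
    apply/subsetP => s; rewrite !inE => /andP[-> ds] /=.
    exact: lt_le_trans delta_i ds.
  split=> // tame_a; apply/eqP; rewrite eqEsubset HH andbT.
  apply/subsetP => s; rewrite !inE => /andP[sG dlt]; rewrite sG /= leNgt.
  apply/negP => ltd.
  (* The two sides differ by (a - t) + s (t - a), of value at least delta_i, which exceeds the value
     of t - s t. *)
  have wa : vbar (j a - j (s a)) = vbar (j t - j (s t)).
    have -> : j a - j (s a) = j t - j (s t) + ((j a - j t) + j (s (t - a))).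
      rewrite !rmorphB [RHS]addrA [j t - _ + _]addrC [j a - j t + _]addrA.
      by rewrite !subrK addrA subrK.
    apply: val_addl; apply: (lt_le_trans ltd).
    rewrite val_addge ?(val_gal_embed v_hens vbar_ext ji) ?rmorphB ?jt ?ja //.
    by rewrite val_subC.
  have sa : s a != a.
    apply: contraTneq ltd => sa; rewrite -wa sa subrr val0 -leNgt.
    by case: delta.
  rewrite -ja in tame_a.
  have [b dimb wb] := tame_approximation v_hens vbar_ext ji gal_M tame_a sG sa.
  have wtb : vbar (j t - j (s t)) <= vbar (theta - j b).
    have -> : theta - j b = (theta - j a) + (j a - j b) by rewrite addrA subrK.
    by rewrite val_addge -?wa // wa ltW // ja.
  rewrite -!(elt_degree_img ji) ja in dimb.
  case: i ir ja dlt delta_i HH dimb ltd {tame_a wa} => [|k] kr ja dlt _ _ dimb _.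
    (* For i = 0 no element has degree below 1. *)
    by move: dimb; rewrite deg0 (elt_degree_img ji) ltnNge adim_gt0.
  have := okutsu_le k (j b) kr dimb; rewrite leNgt.
  by rewrite (lt_le_trans dlt wtb).
move=> tame_theta.
case: r alpha alpha_okutsu alpha_sep alpha_r deg0 deg_lt okutsu_le okutsu_lt
  deg_mono delta_lt => [|k] al al_okutsu al_sep al_r deg0 deg_lt okutsu_le _ _ _.
  (* For r = 0 the element theta would have degree 1. *)
  by move: theta_deg; rewrite -al_r deg0.
have deg_al : (elt_degree iota al`_k < elt_degree iota theta)%N.
  by rewrite -al_r deg_lt.
have theta_le b : (elt_degree iota b < elt_degree iota theta)%N ->
    vbar (theta - b) <= delta vbar theta al k.
  by move=> db; apply: okutsu_le; rewrite ?al_r.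
have [M [j [ji gal_M jsurj]]] :
    exists (M : splittingFieldType K) (j : {rmorphism M -> Kbar}),
    [/\ forall a : K, j a%:A = iota a, galois 1 {:M}
      & forall x, x \in [:: theta; al`_k] -> exists t, j t = x].
  apply: exists_galois_extension => x; rewrite !inE => /orP[] /eqP ->.
    exact/theta_sep/adjoin_id.
  exact/(al_sep k (ltnSn k))/adjoin_id.
have [t jt] := jsurj theta (mem_head _ _).
have [a ja] : exists a, j a = al`_k by apply: jsurj; rewrite !inE eqxx orbT.
(* This is omega <= delta: an approximation of smaller degree is bounded by the last finite
   delta. *)
have conj_le s : s \in 'Gal({:M} / 1)%g -> s t != t ->
    vbar (j t - j (s t)) <= delta vbar theta al k.
  move=> sG st; rewrite -jt in tame_theta.
  have [b dimb wb] := tame_approximation v_hens vbar_ext ji gal_M tame_theta sG st.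
  apply: (le_trans wb); rewrite jt; apply: theta_le.
  by rewrite -jt !(elt_degree_img ji).
have map_minp : map_poly iota (minpoly iota theta) = map_poly j (minPoly 1 t).
  rewrite -(map_minpoly ji) -map_poly_comp jt.
  exact/esym/(eq_map_poly (ji : _ \o _ =1 _)).
exists (delta vbar theta al k).
  split=> [_ [b /= db <-]|ub ubP]; first exact: theta_le.
  by apply: ubP; exists al`_k.
split=> [|_ [x [nx rx] <-]]; last first.
  have [rs /= [rsG _ mp]] := galois_factors (subvf _) gal_M t (memvf t).
  move: rx; rewrite map_minp mp rmorph_prod /root horner_prod prodf_seq_eq0.
  case/hasP => _ /mapP[s srs ->] /=.
  rewrite rmorphB /= map_polyX map_polyC hornerXsubC subr_eq0 => /eqP xE.
  rewrite xE -{1}jt; apply: conj_le; first exact: (subsetP rsG).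
  by apply: contraNneq nx => st; rewrite xE st; apply/eqP.
have ta : t \notin <<1; a>>%VS.
  apply: contraL deg_al => ta; rewrite -leqNgt -ja -jt !(elt_degree_img ji).
  by apply/dimvS/FadjoinP; split; [exact: sub1v|].
have galF : galois <<1; a>> {:M} by apply: galoisS gal_M; rewrite sub1v subvf.
(* Krasner's argument: for s fixing alpha_{r-1} and moving theta, theta - s theta is the difference
   of theta - alpha_{r-1} and its conjugate, both of value delta, so the bound is attained. *)
have [s sS st] : exists2 s, s \in 'Gal({:M} / <<1; a>>)%g & s t != t.
  apply: contrapT => none; move/negP: ta; apply.
  rewrite -(galois_fixedField galF); apply/fixedFieldP => [|s sS].
    exact: memvf.
  by apply/eqP/negPn/negP => st; apply: none; exists s.
have sG : s \in 'Gal({:M} / 1)%g by apply: (subsetP (galS _ (sub1v _))) sS.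
have sa : s a = a by apply: fixed_gal sS (memv_adjoin _ _); exact: subvf.
exists (j (s t)).
  split; first by rewrite -jt fmorph_eq.
  rewrite map_minp fmorph_root; apply: root_minPoly_gal sG _ => //.
    exact: sub1v.
  exact: memvf.
apply/le_anti; rewrite -{1}jt conj_le //=.
have -> : theta - j (s t) = (theta - al`_k) - j (s (t - a)).
  by rewrite !rmorphB /= sa ja opprB addrA subrK.
rewrite val_subge // (val_gal_embed v_hens vbar_ext ji) rmorphB jt ja //.
Qed.
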